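(* Let $\Gamma$ be an infinite Abelian group which is neither a torsion group nor torsion-free, and let $T$ be a tree of diameter $4$ with central vertex $v_c$. Then $T$ is $\Gamma$-vertex magic if and only if $T$ satisfies one of the following: (i) every non-pendant vertex of $T$ is in $\Omega_{\mathfrak{s}}(T)$; (ii) $v_c\in \Omega_{\mathfrak{w}}(T)$ and all other non-pendant vertices of $T$ are in $\Omega_{\mathfrak{s}}(T)$; (iii) $v_c$ is in $\Omega_{\mathfrak{n}}(T)$ or in $\Omega_{\mathfrak{p}}(T)$, and $\gcd(\deg(v_c)-1,e(\Gamma))\neq 1$.
   Context: Graphs are finite, simple and undirected. For an additive Abelian group $\Gamma$ with identity $0$ and a graph $G$, a $\Gamma$-vertex magic labeling is a map $\ell:V(G)\to\Gamma\setminus\{0\}$ for which there is $\mu\in\Gamma$ with $w(v)=\sum_{u\in N(v)}\ell(u)=\mu$ for every vertex $v$; $G$ is $\Gamma$-vertex magic if it has such a labeling. A pendant vertex has degree $1$; a support vertex is a vertex adjacent to a pendant vertex. $\Omega_{\mathfrak{p}}(T)$ is the set of pendant vertices, $\Omega_{\mathfrak{s}}(T)$ the strong support vertices (adjacent to at least two pendants), $\Omega_{\mathfrak{w}}(T)$ the weak support vertices (adjacent to exactly one pendant), $\Omega_{\mathfrak{n}}(T)$ the neutral vertices (neither pendant nor support). A tree of diameter $4$ has a unique central vertex $v_c$. A torsion group has all elements of finite order; a torsion-free group has only $0$ of finite order. The torsion elements $\Gamma_T$ form a subgroup; the exponent of a group is the least positive $n$ with $ng=0$ for all its elements ($\infty$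 if none), and by the paper's convention, for $\Gamma$ not torsion-free, $e(\Gamma)$ denotes $e(\Gamma_T)$.
   Formalization: When e(Γ) is infinite, gcd(deg(v_c)-1, e(Γ)) is undefined in the source, and no value depending only on deg(v_c)-1 makes the claim true; here it is read as the largest divisor of deg(v_c)-1 that divides the order of some torsion element of Γ. *)

(* Defs.v *)
From mathcomp Require Import all_boot all_algebra.
From mathcomp Require Import boolp classical_sets cardinality.

Set Implicit Arguments.
Unset Strict Implicit.
Unset Printing Implicit Defensive.

Import GRing.Theory.

(** * Finite simple graphs *)

Record sgraph := SGraph {
  vertex :> finType;
  adj : rel vertex;
  adj_sym : symmetric adj;
  adj_irrefl : irreflexive adj
}.

Section Graphs.
Variable T : sgraph.
Implicit Types u v w : T.

Definition nbhd v : {set T} := [set u | adj v u].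

Definition deg v : nat := #|nbhd v|.

Definition pendants : {set T} := [set v | deg v == 1].

Definition supports : {set T} := [set v | [exists u in pendants, adj v u]].

Definition strong_supports : {set T} :=
  [set v | 2 <= #|nbhd v :&: pendants|].

Definition weak_supports : {set T} :=
  [set v | #|nbhd v :&: pendants| == 1].

Definition neutrals : {set T} :=
  [set v | (v \notin pendants) && (v \notin supports)].

Definition walk_of_length u v (n : nat) : bool :=
  [exists p : n.-tuple T, path (@adj T) u p && (last u p == v)].

(* The least length of a walk from u to v. In a connected graph it is less
   than the number of vertices; that number is the default value when v cannot
   be reached from u. *)
Definition dist u v : nat := find (walk_of_length u v) (iota 0 #|T|).

Definition ecc v : nat := \max_(w : T) dist v w.

Definition diameter : nat := \max_(v : T) ecc v.

Definition central v : Prop := forall w, ecc v <= ecc w.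

Definition connected_graph : Prop := forall u v, connect (@adj T) u v.

Definition acyclic : Prop :=
  forall c : seq T, 2 < size c -> uniq c -> ~~ cycle (@adj T) c.

Definition is_tree : Prop := [/\ 0 < #|T|, connected_graph & acyclic].

End Graphs.

(** * Torsion and exponents in abelian groups *)

Section Torsion.
Local Open Scope ring_scope.
Local Open Scope classical_set_scope.
Variable G : zmodType.

Definition torsion_elt (g : G) : Prop := exists2 n, (0 < n)%N & g *+ n = 0.

(* The torsion subgroup. *)
Definition torsion_part : set G := [set g | torsion_elt g].

Definition torsion_group : Prop := forall g : G, torsion_elt g.

Definition torsion_free : Prop := forall g : G, torsion_elt g -> g = 0.

Definition annihilates (A : set G) : pred nat :=
  fun n => `[< (0 < n)%N /\ forall g, A g -> g *+ n = 0 >].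

(* The least positive n with n g = 0 for all g in A; None stands for infinity. *)
Definition exponent_on (A : set G) : option nat :=
  match pselect (exists n, annihilates A n) with
  | left exn => Some (ex_minn exn)
  | right _ => None
  end.

Definition order (g : G) : option nat := exponent_on [set g].

(* The exponent e(G) of a group that is not torsion-free is by convention the
   exponent of its torsion subgroup. *)
Definition exponent : option nat := exponent_on torsion_part.

(* gcd(m, e(G)) for m > 0. When e(G) is infinite it is read as the formal
   (Steinitz) least common multiple of the orders of the torsion elements: an
   integer k divides it when k divides the order of some torsion element. No
   convention that depends on m alone, such as gcd(m, oo) = m, would do: the
   groups Z x Z(2^oo) and Z x Z(3^oo) both have infinite exponent, but only the
   first one has a nonzero element killed by 2. *)
Definition gcd_exponent (m : nat) : nat :=
  match exponent with
  | Some n => gcdn m n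
  | None =>
      \max_(k < m.+1 | (k %| m)%N &&
              `[< exists g n, order g = Some n /\ (k %| n)%N >]) k
  end.

End Torsion.

Arguments torsion_group : clear implicits.
Arguments torsion_free : clear implicits.
Arguments exponent : clear implicits.
Arguments gcd_exponent : clear implicits.

(** * Vertex magic labelings *)

Section Magic.
Local Open Scope ring_scope.
Variables (G : zmodType) (T : sgraph).

Definition weight (l : T -> G) (v : T) : G := \sum_(u in nbhd v) l u.

Definition vertex_magic_labeling (l : T -> G) : Prop :=
  (forall v, l v != 0) /\ exists mu : G, forall v, weight l v = mu.

Definition vertex_magic : Prop := exists l : T -> G, vertex_magic_labeling l.

End Magic.

(* Main.v *)
Require Import Defs.
From mathcomp Require Import all_boot all_algebra.
From mathcomp Require Import boolp classical_sets cardinality.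

Set Implicit Arguments.
Unset Strict Implicit.
Unset Printing Implicit Defensive.

Import GRing.Theory.

(** In a tree of diameter 4 the central vertex [vc] has at least two
    non-pendant neighbours, every other non-pendant vertex is adjacent to [vc],
    and all its other neighbours are pendant.  For a labeling with constant
    weight [mu], a pendant vertex forces the label [mu] on its neighbour.
    - If [vc] is a support, it has label [mu], so the pendants at any other
      non-pendant vertex sum to 0, which needs at least two of them.
    - If [vc] is neutral, all its neighbours have label [mu], so
      [(deg vc - 1) mu = 0]; a nonzero such [mu] exists exactly when the gcd of
      [deg vc - 1] and the exponent is not 1.
    Conversely, in an infinite group [k > 0] nonzero elements can be chosen with
    any prescribed sum (nonzero if [k = 1]), so labels [mu] on the supports
    extend to the pendants.  When [vc] is a weak support with [d] non-pendant
    neighbours its only pendant gets [(1 - d) mu], which is nonzero for [mu] of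
    infinite order. *)

(** * Simple paths and distances in trees *)

Section SimplePaths.
Variable T : sgraph.
Implicit Types (x y z : T) (p q : seq T).

(** The start [x] is kept apart from [p], so that [size p] is the number of edges. *)
Definition spath x p := path (@adj T) x p && uniq (x :: p).

Lemma spath_take x p n : spath x p -> spath x (take n p).
Proof.
case/andP=> xp /= /andP[nx up]; rewrite /spath take_path //= take_uniq // andbT.
by apply: contra nx; apply: mem_take.
Qed.

Lemma path_adj_rev x p y : path (@adj T) x (rcons p y) -> path (@adj T) y (rev (x :: p)).
Proof.
have := rev_path (@adj T) x (rcons p y); rewrite last_rcons belast_rcons => ->.
by rewrite (eq_path (e' := @adj T)) // => u v; rewrite adj_sym.
Qed.

(* If the first steps differ, cutting both paths at the first vertex [w] of [p]
   lying on [q] yields a cycle. *)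
Lemma acyclic_spath_uniq x p q : acyclic T -> spath x p -> spath x q ->
  last x p = last x q -> p = q.
Proof.
move=> acT; elim: p x q => [|y p IH] x [|z q] //.
- by move=> _ /andP[_ /= /andP[nx _]] /= xq; rewrite {1}xq mem_last in nx.
- by move=> /andP[_ /= /andP[nx _]] _ /= xq; rewrite -xq mem_last in nx.
have [<-{z}|yz] := eqVneq y z.
  move=> /andP[/= /andP[_ yp] /andP[_ up]] /andP[/= /andP[_ yq] /andP[_ uq]] e.
  by rewrite (IH y q) // /spath ?yp ?yq.
move=> /andP[xp up] /andP[xq uq] e.
have hq : has (mem (z :: q)) (y :: p).
  apply/hasP; exists (last y p); first exact: mem_last.
  by move: e => /= ->; apply: mem_last.
have := hq; move: xp up xq uq yz.
(* The [ohead] equations remember the distinct first steps once both paths are generalized; they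
   exclude the degenerate cycle in which both paths reach [w] at once. *)
have : ohead (y :: p) = Some y by []. have : ohead (z :: q) = Some z by [].
move: {IH e hq} (y :: p) (z :: q) => {}p {}q + + xp up xq uq yz hp.
case: (split_find hp) xp up => w p1 p2 wq np1 {hp}.
case/splitPr: q / wq np1 xq uq => q1 q2 np1 xq uq xp up hq hp1.
set c := x :: rcons p1 w ++ rev q1.
suff [c2 uc cc] : [/\ 2 < size c, uniq c & cycle (@adj T) c].
  by case/negP: (acT c c2 uc).
rewrite {}/c; split.
- rewrite /= size_cat size_rcons size_rev.
  case: p1 q1 {np1 xq uq xp up} hp1 hq => [|? ?] [|? ?] //= -[hp1] [hq].
  by rewrite -hp1 -hq eqxx in yz.
- move: up uq; rewrite /= !mem_cat !mem_rcons !cat_uniq !rcons_uniq /=.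
  rewrite !inE !negb_or mem_rev rev_uniq.
  case/and4P=> /andP[/andP[-> ->] _] /andP[wp1 up1] _ _.
  case/andP=> /and3P[-> _ _] /and3P[uq1 /andP[wq1 _] _].
  rewrite /= wp1 up1 uq1 /= andbT -all_predC.
  apply/allP=> v; rewrite mem_rev => vq /=.
  rewrite mem_rcons inE negb_or; apply/andP; split.
    by apply: contraNneq wq1 => <-.
  by apply: contra np1 => vp; apply/hasP; exists v; rewrite //= mem_cat vq.
move: xp xq; rewrite !cat_path => /andP[xp _] /= /and3P[xq1 lq _].
rewrite rcons_cat cat_path xp last_rcons /=.
have := @path_adj_rev x q1 w; rewrite rcons_path xq1 lq => /(_ isT).
by rewrite rev_cons.
Qed.

Lemma spath_exists x y : connected_graph T -> exists2 p, spath x p & last x p = y.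
Proof.
move=> /(_ x y) /connectP[p xp ->].
by case: (shortenP xp) => q xq uq _; exists q => //; rewrite /spath xq.
Qed.

(** Removing the loops of [q] leaves a simple path with the same ends, which is [p] by
    uniqueness. *)
Lemma acyclic_spath_min x p q : acyclic T -> spath x p -> path (@adj T) x q ->
  last x p = last x q -> size p <= size q.
Proof.
move=> acT sp xq; case: (shortenP xq) => q' xq' uq' sq e.
rewrite (acyclic_spath_uniq acT sp _ e) ?/spath ?xq' //.
by apply: uniq_leq_size sq; case/andP: uq'.
Qed.

Lemma dist_spath x p : acyclic T -> spath x p -> dist x (last x p) = size p.
Proof.
move=> acT sp; have /andP[xp up] := sp.
(* [dist] only searches lengths below [#|T|]. *)
have lt : size p < #|T| by rewrite -[_.+1]/(size (x :: p)) -(card_uniqP up) max_card.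
have wp : walk_of_length x (last x p) (size p).
  by apply/existsP; exists (in_tuple p); rewrite /= xp eqxx.
apply/eqP; rewrite eqn_leq /dist; apply/andP; split.
  rewrite leqNgt; apply/negP=> /(before_find 0).
  by rewrite nth_iota // add0n wp.
have hw : has (walk_of_length x (last x p)) (iota 0 #|T|).
  by apply/hasP; exists (size p); rewrite ?mem_iota.
have := nth_find 0 hw; rewrite nth_iota ?add0n; last by move: hw; rewrite has_find size_iota.
case/existsP=> q /andP[xq /eqP lq].
by have := acyclic_spath_min acT sp xq (esym lq); rewrite size_tuple.
Qed.

(** Distances from [x] are the lengths of the simple paths from [x], so later arguments can avoid
    [dist]. *)
Lemma ecc_leP x n : is_tree T ->
  ecc x <= n <-> (forall p, spath x p -> size p <= n).
Proof.
case=> _ cT acT; split=> [/bigmax_leqP h p sp|h].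
  by rewrite -(dist_spath acT sp); apply: h.
apply/bigmax_leqP=> y _; have [p sp <-] := spath_exists x y cT.
by rewrite dist_spath //; apply: h.
Qed.

End SimplePaths.

(** * The shape of a tree of diameter 4 *)

Section DiameterFour.
Variables (T : sgraph) (vc : T).
Hypotheses (treeT : is_tree T) (diamT : diameter T = 4) (centT : central vc).

Let cT : connected_graph T. Proof. by case: treeT. Qed.
Let acT : acyclic T. Proof. by case: treeT. Qed.

Lemma diameter4_spath : exists u a c b w : T, spath u [:: a; c; b; w].
Proof.
have T0 : 0 < #|T| by case: treeT.
have [u eu] := eq_bigmax (@ecc T) T0.
have [w ew] := eq_bigmax (dist u) T0.
have [p sp lp] := spath_exists u w cT.
have := dist_spath acT sp; rewrite lp -ew.
have -> : \max_i dist u i = 4 by rewrite -diamT [diameter T]eu.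
case: p sp {lp} => [|a [|c [|b [|z []]]]] // sp _.
by exists u, a, c, b, z.
Qed.

Lemma diameter4_spath_size (x : T) p : spath x p -> size p <= 4.
Proof.
by move: p; apply/(ecc_leP x 4 treeT); rewrite -diamT; apply: (leq_bigmax (F := @ecc T)).
Qed.

(** Otherwise the two branches at [c] join into a path [u, a, c, p1, p2, p3] of length 5. It is
    simple, since a vertex common to both branches would be reached from [c] by two simple paths. *)
Lemma spath_cons_diameter4 (u a c p1 p2 p3 : T) :
  spath c [:: a; u] -> spath c [:: p1; p2; p3] -> a = p1.
Proof.
move=> s1 s2; apply/eqP/negPn/negP=> ap1.
have U p q : spath c p -> spath c q -> last c p = last c q -> p = q.
  exact: acyclic_spath_uniq.
have s1' := spath_take 1 s1; have s2' := spath_take 2 s2; have s2'' := spath_take 1 s2.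
rewrite /= ?take0 in s1' s2' s2''.
suff /diameter4_spath_size : spath u [:: a; c; p1; p2; p3] by [].
have := s1; have := s2; rewrite /spath /= !inE !negb_or !andbT.
case/andP=> /and3P[-> -> ->] /and3P[/and3P[-> -> ->] /andP[-> ->] ->].
case/andP=> /andP[h1 h2] /andP[/andP[h3 h4] h5].
rewrite adj_sym h2 adj_sym h1 /= [u == a]eq_sym h5 [u == c]eq_sym h4.
rewrite [a == c]eq_sym h3 ap1 /=.
rewrite !andbT; apply/andP; split; last apply/andP; last split; last 2 first.
- by apply/eqP=> e; have := U _ _ s1' s2' e.
- by apply/eqP=> e; have := U _ _ s1' s2 e.
apply/and3P; split; apply/eqP=> e.
- by have := U _ _ s1 s2'' e.
- by case: (U _ _ s1 s2' e) => /eqP; rewrite (negPf ap1).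
- by have := U _ _ s1 s2 e.
Qed.

(** The middle vertex [c] of a path [u, a, c, b, w] has eccentricity at most 2: a path of length 3
    from [c] would have to start with both [a] and [b]. Centrality transfers the bound to [vc]. *)
Lemma central_spath_size p : spath vc p -> size p <= 2.
Proof.
move: p; apply/(ecc_leP vc 2 treeT).
have [u [a [c [b [w]]]]] := diameter4_spath.
rewrite /spath /= !inE !negb_or !andbT.
case/andP=> /and4P[ua ac cb bw].
case/and4P=> /and4P[nua nuc nub nuw] /and3P[nac nab naw] /andP[ncb ncw] nbw.
apply: leq_trans (centT c) _; apply/(ecc_leP c 2 treeT) => -[|p1 [|p2 [|p3 p]]] // sp.
have {}sp : spath c [:: p1; p2; p3] by have := spath_take 3 sp; rewrite /= take0.
have e1 : a = p1.
  apply: (@spath_cons_diameter4 u) sp.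
  by rewrite /spath /= !inE adj_sym ac adj_sym ua !negb_or eq_sym nac eq_sym nuc eq_sym nua.
have e2 : b = p1.
  apply: (@spath_cons_diameter4 w) sp.
  by rewrite /spath /= !inE cb bw !negb_or ncb ncw nbw.
by rewrite e1 e2 eqxx in nab.
Qed.

Lemma pendantP (v : T) : v \in pendants T <-> exists s : T, nbhd v = [set s].
Proof. by rewrite inE /deg; split=> [/cards1P//|[s ->]]; rewrite cards1. Qed.

Lemma pendantPn (v x y : T) : adj v x -> adj v y -> x != y -> v \notin pendants T.
Proof.
move=> vx vy xy; apply/negP=> /pendantP[s es].
have : x \in nbhd v by rewrite inE.
have : y \in nbhd v by rewrite inE.
by rewrite es !inE => /eqP ys /eqP xs; rewrite xs ys eqxx in xy.
Qed.

Lemma adj_neq (x y : T) : adj x y -> x != y.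
Proof. by apply: contraTneq => ->; rewrite adj_irrefl. Qed.

Lemma spath1 (x y : T) : adj x y -> spath x [:: y].
Proof. by move=> xy; rewrite /spath /= xy inE adj_neq. Qed.

Lemma spath2 (x y z : T) : adj x y -> adj y z -> x != z -> spath x [:: y; z].
Proof. by move=> xy yz xz; rewrite /spath /= xy yz !inE negb_or xz !adj_neq. Qed.

(** Take the ends [u], [w] of a path of length 4. The paths from [vc] to them have length at most 2;
    unless both have length 2 and start differently, they give a walk from [u] to [w] shorter than
    4. Their first vertices are the required neighbours. *)
Lemma central_two_nonpendant_nbrs : exists a b : T,
  [/\ a != b, adj vc a, adj vc b, a \notin pendants T & b \notin pendants T].
Proof.
have [u [a [c [b [w sp]]]]] := diameter4_spath.
have min q : path (@adj T) u q -> last u q = w -> 4 <= size q.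
  by move=> uq e; apply: (acyclic_spath_min acT sp uq).
have [p s1 l1] := spath_exists vc u cT; have [q s2 l2] := spath_exists vc w cT.
have := central_spath_size s1; have := central_spath_size s2.
case/andP: s1 => + _; case/andP: s2 => + _.
case: q l2 => [|b' [|w' []]] //= l2 + + _.
all: case: p l1 => [|a' [|u' []]] //= l1; rewrite ?andbT; subst.
- by move=> _ _ _; have := min [::] isT erefl.
- by rewrite adj_sym => _ h _; have := min [:: w]; rewrite /= h => /(_ isT erefl).
- move=> _ /andP[h1 h2] _; have := min [:: a'; w].
  by rewrite /= adj_sym h2 adj_sym h1 => /(_ isT erefl).
- by move=> h _ _; have := min [:: w]; rewrite /= h => /(_ isT erefl).
- rewrite (adj_sym vc u) => h1 h2 _; have := min [:: vc; w].
  by rewrite /= h1 h2 => /(_ isT erefl).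
- move=> h1 /andP[h2 h3] _; have := min [:: a'; vc; w].
  by rewrite /= (adj_sym u) h3 (adj_sym a') h2 h1 => /(_ isT erefl).
- by move=> /andP[h1 h2] _ _; have := min [:: b'; w]; rewrite /= h1 h2 => /(_ isT erefl).
- move=> /andP[h1 h2] h3 _; have := min [:: vc; b'; w].
  by rewrite /= (adj_sym u) h1 h2 h3 => /(_ isT erefl).
move=> /andP[h1 h2] /andP[h3 h4] _; exists a', b'; split=> //.
- apply/eqP=> e; rewrite -e in h2.
  by have := min [:: a'; w]; rewrite /= adj_sym h4 h2 => /(_ isT erefl).
- apply: (pendantPn (x := vc) (y := u)) => //; first by rewrite adj_sym.
  apply/eqP=> e.
  by have := min [:: b'; w]; rewrite /= -e h1 h2 => /(_ isT erefl).
apply: (pendantPn (x := vc) (y := w)) => //; first by rewrite adj_sym.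
apply/eqP=> e; have := min [:: a'; w].
by rewrite /= -e adj_sym h4 adj_sym h3 => /(_ isT erefl).
Qed.

Lemma central_nonpendant : vc \notin pendants T.
Proof.
by have [a [b [ab va vb _ _]]] := central_two_nonpendant_nbrs; apply: pendantPn ab.
Qed.

(** If [v] were reached only through some [y], a second neighbour [z] of [v] would extend the path
    to length 3. *)
Lemma nonpendant_adj_central (v : T) : v != vc -> v \notin pendants T -> adj vc v.
Proof.
move=> nv pv; have [p sp lp] := spath_exists vc v cT.
have := central_spath_size sp.
case: p sp lp => [|y [|v' []]] //= sp lp _.
- by rewrite lp eqxx in nv.
- by move: sp; rewrite lp => /andP[/= /andP[]].
subst v'; case/andP: sp => /= /and3P[hy yv _] _.
have [z vz zy] : exists2 z, adj v z & z != y.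
  apply: contrapT => h; case/negP: pv; apply/pendantP; exists y; apply/setP=> z; rewrite !inE.
  have [->|zy] := eqVneq z y; first by rewrite adj_sym.
  by apply/negP=> vz; apply: h; exists z.
have [ez|nz] := eqVneq vc z; first by rewrite ez adj_sym.
suff /central_spath_size : spath vc [:: y; v; z] by [].
rewrite /spath /= !inE !negb_or yv hy vz nz [vc == v]eq_sym nv [y == z]eq_sym zy.
by rewrite !adj_neq.
Qed.

(** Otherwise [z] is adjacent to [vc] too, and [vc], [v], [z] form a triangle. *)
Lemma noncentral_nbr_pendant (v z : T) :
  v != vc -> v \notin pendants T -> adj v z -> z != vc -> z \in pendants T.
Proof.
move=> nv pv vz nz; apply/negPn/negP=> pz.
have cv := nonpendant_adj_central nv pv; have cz := nonpendant_adj_central nz pz.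
rewrite eq_sym in nz.
by have := acyclic_spath_uniq acT (spath1 cz) (spath2 cv vz nz) erefl.
Qed.

(** The only neighbour of [x] precedes it on the path from [vc]: it is [vc] itself or a vertex
    adjacent to both [vc] and [x]. *)
Lemma pendant_nbr_nonpendant (x s : T) : x \in pendants T -> adj x s -> s \notin pendants T.
Proof.
move=> px xs; have nx : x != vc by apply: contraNneq central_nonpendant => <-.
have [p sp lp] := spath_exists vc x cT; have := central_spath_size sp.
case: p sp lp => [|y [|v' []]] //= sp lp _.
- by rewrite lp eqxx in nx.
- have cx : adj x vc by move: sp; rewrite lp adj_sym => /andP[/= /andP[]].
  have [<-|ns] := eqVneq vc s; first exact: central_nonpendant.
  by case/negP: (pendantPn cx xs ns).
subst v'; case/andP: sp => /= /and3P[cy yx _] _.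
rewrite adj_sym in yx.
have [<-|ns] := eqVneq y s; last by case/negP: (pendantPn yx xs ns).
by apply: (@pendantPn _ x vc) => //; rewrite adj_sym.
Qed.

(** For a non-pendant vertex, the size of this set decides between neutral (0), weak (1) and strong
    (at least 2). *)
Definition pnbhd (v : T) := nbhd v :&: pendants T.

Lemma nbhd_noncentral v : v != vc -> v \notin pendants T -> nbhd v = vc |: pnbhd v.
Proof.
move=> nv pv; apply/setP=> z; rewrite [LHS]inE finset.in_setU1 finset.in_setI [z \in nbhd v]inE.
have [->|nz] /= := eqVneq z vc; first by rewrite adj_sym nonpendant_adj_central.
by case vz : (adj v z) => //=; rewrite (noncentral_nbr_pendant nv pv).
Qed.

Lemma central_notin_pnbhd v : vc \notin pnbhd v.
Proof. by rewrite finset.in_setI (negPf central_nonpendant) andbF. Qed.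

Lemma pnbhd_noncentral_gt0 v : v != vc -> v \notin pendants T -> 0 < #|pnbhd v|.
Proof.
move=> nv pv; rewrite lt0n; apply: contra (pv) => /eqP p0.
by rewrite inE /deg nbhd_noncentral // cardsU1 p0 central_notin_pnbhd.
Qed.

End DiameterFour.

(** * Torsion, exponents and sums of nonzero elements *)

Section Groups.
Local Open Scope ring_scope.
Variable G : zmodType.
Implicit Types (g : G) (A : set G).

Lemma mulrn_gcd g m n : (0 < m)%N -> g *+ m = 0 -> g *+ n = 0 -> g *+ gcdn m n = 0.
Proof.
move=> m0 gm gn; case: (egcdnP n m0) => km kn e _.
have : g *+ (km * m) = 0 by rewrite mulnC mulrnA gm mul0rn.
by rewrite e mulrnDr [(kn * n)%N]mulnC mulrnA gn mul0rn add0r.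
Qed.

Lemma exponent_on_some A n : exponent_on A = Some n ->
  [/\ (0 < n)%N, forall g, A g -> g *+ n = 0 &
      forall k, (0 < k)%N -> (forall g, A g -> g *+ k = 0) -> (n <= k)%N].
Proof.
rewrite /exponent_on; case: pselect => // e [<-].
case: ex_minnP => m /asboolP[m0 am] min; split=> // k k0 ak.
by apply: min; apply/asboolP.
Qed.

Lemma exponent_on_none A n : exponent_on A = None ->
  (0 < n)%N -> ~ (forall g, A g -> g *+ n = 0).
Proof.
rewrite /exponent_on; case: pselect => // e _ n0 an.
by apply: e; exists n; apply/asboolP.
Qed.

(* [order] alone would denote the orbit size of [fingraph]. *)
Lemma order_some g n : Defs.order g = Some n ->
  [/\ (0 < n)%N, g *+ n = 0 & forall k, (0 < k)%N -> g *+ k = 0 -> (n <= k)%N].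
Proof.
case/exponent_on_some=> n0 gn min; split=> //; first exact: gn.
by move=> k k0 gk; apply: min => // _ ->.
Qed.

Lemma order_dvdn g m : (0 < m)%N -> g *+ m = 0 ->
  exists2 n, Defs.order g = Some n & (n %| m)%N.
Proof.
move=> m0 gm; case e : (Defs.order g) => [n|]; last first.
  by case: (exponent_on_none e m0) => _ ->.
exists n => //; have [n0 gn min] := order_some e.
have /min := mulrn_gcd m0 gm gn; rewrite gcdn_gt0 m0 => /(_ isT) le.
have <- : gcdn m n = n; last exact: dvdn_gcdl.
by apply/eqP; rewrite eqn_leq le andbT dvdn_leq // dvdn_gcdr.
Qed.

(** For a finite exponent [n], a torsion element killed by [m] is also killed by [gcdn m n]. For an
    infinite one, the order of such an element divides [m] and enters the maximum. *)
Lemma gcd_exponent_neq1 m : (0 < m)%N ->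
  gcd_exponent G m <> 1%N <-> exists2 g : G, g != 0 & g *+ m = 0.
Proof.
move=> m0; rewrite /gcd_exponent; case e : (exponent G) => [n|].
  have [n0 an min] := exponent_on_some e.
  split=> [d1|[g g0 gm] d1]; last first.
    have gn : g *+ n = 0 by apply: an; exists m.
    by case/eqP: g0; rewrite -[g]mulr1n -d1 mulrn_gcd.
  set d := gcdn m n in d1; have d0 : (0 < d)%N by rewrite gcdn_gt0 m0.
  have dn : (n %/ d * d)%N = n by rewrite divnK ?dvdn_gcdr.
  have q0 : (0 < n %/ d)%N by rewrite divn_gt0 // dvdn_leq ?dvdn_gcdr.
  (* As [d != 1], [n %/ d] is smaller than the exponent and cannot kill all torsion; the multiple
     [g *+ (n %/ d)] is then killed by [d], a divisor of [m]. *)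
  have [g tg gq] : exists2 g : G, torsion_elt g & g *+ (n %/ d) != 0.
    apply: contrapT => h; have : (n <= n %/ d)%N.
      apply: min => // g tg; apply/eqP/negPn/negP=> gq; apply: h; by exists g.
    by rewrite leqNgt ltn_Pdiv // ltn_neqAle d0 andbT eq_sym; apply/eqP.
  exists (g *+ (n %/ d)) => //.
  have /dvdnP[k ->] : (d %| m)%N by exact: dvdn_gcdl.
  by rewrite mulnC -mulrnA mulnA dn mulrnA (an g tg) mul0rn.
split=> [b1|[g g0 gm]]; last first.
  have [n og nm] := order_dvdn m0 gm; have [n0 gn _] := order_some og.
  have n1 : (1 < n)%N.
    rewrite ltn_neqAle n0 andbT; apply: contraNneq g0 => n1.
    by rewrite -gn -n1 mulr1n.
  have ltn : (n < m.+1)%N by rewrite ltnS dvdn_leq.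
  move=> b1; have : (n <= 1)%N; last by rewrite leqNgt n1.
  rewrite -[X in (_ <= X)%N]b1.
  apply: (leq_bigmax_cond (F := fun k : 'I_m.+1 => nat_of_ord k) (Ordinal ltn)).
  by rewrite /= nm; apply/asboolP; exists g, n.
have [k /andP[km /asboolP[g [n [og kn]]]] k1] : exists2 k : 'I_m.+1,
    (k %| m)%N && `[< exists (g : G) n, Defs.order g = Some n /\ (k %| n)%N >] & (1 < k)%N.
  apply: contrapT => h; apply: b1; apply/eqP; rewrite eqn_leq; apply/andP; split.
    apply/bigmax_leqP => k hk; rewrite leqNgt; apply/negP=> k1; apply: h; by exists k.
  have lt1 : (1 < m.+1)%N by [].
  apply: (leq_bigmax_cond (F := fun k : 'I_m.+1 => nat_of_ord k) (Ordinal lt1)).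
  rewrite dvd1n; apply/asboolP; have [n on _] := order_dvdn (ltn0Sn 0) (mul0rn G 1).
  by exists 0, n.
have [n0 gn min] := order_some og; have k0 : (0 < k)%N by exact: ltnW.
(* Nonzero because [n %/ k] is below the order [n] of [g], and killed by [k], which divides [m]. *)
exists (g *+ (n %/ k)).
  apply/eqP=> gq; have : (n <= n %/ k)%N.
    by apply: min => //; rewrite divn_gt0 // dvdn_leq.
  by rewrite leqNgt ltn_Pdiv.
have /dvdnP[q {2}->] := km.
by rewrite mulnC -mulrnA mulnA divnK // mulrnA gn mul0rn.
Qed.

Lemma infinite_avoid2 (x y : G) : infinite_set [set: G]%classic ->
  exists2 g, g != x & g != y.
Proof.
move=> inf; apply: contrapT => h; apply: inf.
apply: (@sub_finite_set _ _ [set x; y]%classic); last exact: finite_set2.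
move=> g _; apply: contrapT => /not_orP[gx gy].
by apply: h; exists g; apply/eqP.
Qed.

(** Induction on the size of [A]: one index gets a value [a] other than 0 and [t], so the sum
    [t - a] left to the others is nonzero, as a single remaining index requires. *)
Lemma nonzero_sum_exists (I : finType) (A : {set I}) (t : G) :
  infinite_set [set: G]%classic -> (0 < #|A|)%N -> (#|A| = 1%N -> t != 0) ->
  exists2 f : I -> G, (forall i, f i != 0) & \sum_(i in A) f i = t.
Proof.
move=> inf; have [n cA] := ubnP #|A|; elim: n A t cA => // n IH A t cA A0 At.
have /card_gt0P[x xA] := A0.
have cAx : #|A| = #|A :\ x|.+1 by rewrite (cardsD1 x A) xA.
have sumA (f : I -> G) : \sum_(i in A) f i = f x + \sum_(i in A :\ x) f i.
  by rewrite (big_setD1 x xA).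
have [Ax0|Ax0] := posnP #|A :\ x|.
  exists (fun=> t) => [i|]; first by rewrite At // cAx Ax0.
  by rewrite sumA (cards0_eq Ax0) big_set0 addr0.
have [a a0 at0] := infinite_avoid2 0 t inf.
have [||f f0 fA] := IH (A :\ x) (t - a) _ Ax0.
- by rewrite -ltnS -cAx.
- by rewrite subr_eq0 eq_sym.
exists (fun i => if i == x then a else f i) => [i|]; first by case: ifP.
rewrite sumA eqxx (eq_bigr f) ?fA ?subrKC // => i.
by rewrite in_setD1 => /andP[/negPf->].
Qed.

End Groups.

(** * Building labelings from the weight and the central label *)

Section Labelings.
Local Open Scope ring_scope.
Variables (G : zmodType) (T : sgraph) (vc : T).
Hypotheses (treeT : is_tree T) (diamT : diameter T = 4) (centT : central vc).
Implicit Type v : T.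

Let vcN : vc \notin pendants T. Proof. exact: central_nonpendant. Qed.

Lemma mem_pnbhd v u : (u \in pnbhd v) = adj v u && (u \in pendants T).
Proof. by rewrite finset.in_setI [u \in nbhd v]inE. Qed.

Lemma pendant_nbhd x v : x \in pendants T -> adj x v -> nbhd x = [set v].
Proof.
case/pendantP=> s e xv; have : v \in nbhd x by rewrite inE.
by rewrite e inE => /eqP->.
Qed.

Lemma mem_neutrals v : v \notin pendants T -> (v \in neutrals T) = (#|pnbhd v| == 0%N).
Proof.
move=> pv; rewrite inE pv /= inE negb_exists; apply/forallP/eqP=> [h|/cards0_eq h u].
  by apply/eq_card0 => u; rewrite mem_pnbhd andbC; apply/negP/negP.
by rewrite andbC -mem_pnbhd h inE.
Qed.

Lemma weight_noncentral (l : T -> G) v : v != vc -> v \notin pendants T ->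
  weight l v = l vc + \sum_(u in pnbhd v) l u.
Proof.
move=> nv pv; rewrite /weight (nbhd_noncentral treeT diamT centT nv pv).
by rewrite big_setU1 //; apply: central_notin_pnbhd.
Qed.

Lemma weight_split (l : T -> G) v : weight l v =
  \sum_(u in pnbhd v) l u + \sum_(u in nbhd v :\: pendants T) l u.
Proof. by rewrite /weight (big_setID (pendants T)). Qed.

(* [c] is the label of [vc] and [mu] the common weight. *)
Lemma magic_labeling_exists (mu c : G) :
  infinite_set [set: G]%classic -> mu != 0 -> c != 0 ->
  (forall v, v != vc -> v \notin pendants T -> #|pnbhd v| = 1%N -> mu != c) ->
  (0 < #|pnbhd vc|)%N && (c == mu) &&
      ((1 < #|pnbhd vc|)%N || (mu *+ #|nbhd vc :\: pendants T| != mu))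
    || (#|pnbhd vc| == 0%N) && (mu *+ deg vc == mu) ->
  vertex_magic G T.
Proof.
move=> inf mu0 c0 hnc hc.
(* The sum required of the pendants at [v]: the weight [mu] minus the labels of the non-pendant
   neighbours, which are [mu] each around [vc] and just [c] around any other non-pendant vertex. *)
pose t v : G := if v == vc then mu - mu *+ #|nbhd vc :\: pendants T| else mu - c.
have Fex v : exists f : T -> G, (forall i, f i != 0) /\
    ((v \notin pendants T) && (0 < #|pnbhd v|)%N -> \sum_(u in pnbhd v) f u = t v).
  have [/andP[pv p0]|_] := boolP (_ && _); last by exists (fun=> mu).
  have [||f f0 fs] := nonzero_sum_exists (A := pnbhd v) (t := t v) inf.
  - by [].
  - move=> p1; rewrite /t; case: (eqVneq v vc) => [ev|nv] /=; last by rewrite subr_eq0 (hnc v).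
    by rewrite subr_eq0 eq_sym; move: hc; rewrite -ev p1 orbF => /andP[].
  by exists f.
have [F hF] := choice Fex.
(* The support of a pendant [x]; the default [x] only occurs for a vertex without neighbours. *)
pose S (x : T) := odflt x [pick s | adj x s].
have SE x v : v \notin pendants T -> x \in pnbhd v -> S x = v.
  move=> pv; rewrite mem_pnbhd adj_sym /S => /andP[xv px]; case: pickP => [s xs|/(_ v)] /=.
    by have := pendant_nbhd px xs; rewrite (pendant_nbhd px xv) => /set1_inj.
  by rewrite xv.
(* Each pendant reads its label from the function chosen for its own support, so the choices at
   different supports do not interfere. *)
pose l x := if x \in pendants T then F (S x) x else if x == vc then c else mu.
have lsum v : v \notin pendants T -> (0 < #|pnbhd v|)%N -> \sum_(u in pnbhd v) l u = t v.
  move=> pv p0; rewrite -(hF v).2 ?pv //; apply: eq_bigr => u uv.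
  by rewrite /l (SE u v) //; move: uv; rewrite mem_pnbhd => /andP[_ ->].
exists l; split=> [v|].
  by rewrite /l; case: ifP => _; [exact: (hF _).1 | case: ifP].
exists mu => v; have [pv|pv] := boolP (v \in pendants T).
  have [s es] := (pendantP v).1 pv.
  have vs : adj v s by have := set11 s; rewrite -es inE.
  have ps := pendant_nbr_nonpendant treeT diamT centT pv vs.
  rewrite /weight es big_set1 /l (negPf ps); case: eqP => // esc; subst s.
  have : (0 < #|pnbhd vc|)%N by apply/card_gt0P; exists v; rewrite mem_pnbhd adj_sym vs.
  by rewrite lt0n => /negPf h; move: hc; rewrite h orbF /= => /andP[/andP[_ /eqP]].
have [->{v pv}|nv] := eqVneq v vc; last first.
  rewrite weight_noncentral // lsum ?(pnbhd_noncentral_gt0 treeT diamT centT) //.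
  by rewrite /t (negPf nv) /l (negPf vcN) eqxx subrKC.
have nsum : \sum_(u in nbhd vc :\: pendants T) l u = mu *+ #|nbhd vc :\: pendants T|.
  rewrite -sumr_const; apply: eq_bigr => u; rewrite finset.in_setD [u \in nbhd vc]inE /l => /andP[/negPf-> cu].
  by case: eqP => // e; rewrite e adj_irrefl in cu.
rewrite weight_split nsum; case/orP: hc => [/andP[/andP[p0 _] _]|/andP[/eqP/cards0_eq p0 /eqP d]].
  by rewrite lsum // /t eqxx subrK.
by rewrite p0 big_set0 add0r -[RHS]d /deg -(cardsID (pendants T) (nbhd vc)) -/(pnbhd vc) p0 cards0 add0n.
Qed.

End Labelings.

(** * Necessity and sufficiency of the three conditions *)

Theorem theorem4p3 (G : zmodType) (T : sgraph) (vc : T) :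
  infinite_set [set: G]%classic ->
  ~ torsion_group G ->
  ~ torsion_free G ->
  is_tree T ->
  diameter T = 4 ->
  central vc ->
  vertex_magic G T <->
  [\/ (forall v : T, v \notin pendants T -> v \in strong_supports T),
      vc \in weak_supports T /\
        (forall v : T, v != vc -> v \notin pendants T ->
           v \in strong_supports T)
    | (vc \in neutrals T \/ vc \in pendants T) /\
        gcd_exponent G (deg vc - 1) <> 1].
Proof.
move=> inf ntors _ treeT diamT centT.
have vcN := central_nonpendant treeT diamT centT.
have [a [b [ab va vb pa pb]]] := central_two_nonpendant_nbrs treeT diamT centT.
have D2 : 1 < #|nbhd vc :\: pendants T|.
  have <- : #|[set a; b]| = 2 by rewrite cards2 ab.
  apply/subset_leq_card/fintype.subsetP=> z; rewrite !inE => /orP[]/eqP->.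
    by rewrite va andbT; move: pa; rewrite inE.
  by rewrite vb andbT; move: pb; rewrite inE.
have degE : deg vc = #|pnbhd vc| + #|nbhd vc :\: pendants T|.
  by rewrite /deg -(cardsID (pendants T)).
have deg2 : 1 < deg vc by rewrite degE (leq_trans D2) // leq_addl.
have deg1 : 0 < deg vc - 1 by rewrite subn_gt0.
have strongE v : (v \in strong_supports T) = (1 < #|pnbhd v|) by rewrite inE.
have weakE v : (v \in weak_supports T) = (#|pnbhd v| == 1) by rewrite inE.
have neutE := mem_neutrals vcN.
have mudeg (mu : G) : (mu *+ deg vc = mu <-> mu *+ (deg vc - 1) = 0)%R.
  rewrite -{1}(subnK (ltnW deg2)) mulrnDr mulr1n.
  by split=> [e|->]; [apply: (addIr mu); rewrite e add0r | rewrite add0r].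
split.
  case=> l [l0 [mu wmu]].
  have lsup v u : u \in pnbhd v -> l v = mu.
    rewrite mem_pnbhd adj_sym => /andP[uv pu].
    by rewrite -(wmu u) /weight (pendant_nbhd pu uv) big_set1.
  have [p0|p0] := posnP #|pnbhd vc|.
    apply: Or33; split; first by left; rewrite neutE p0.
    have muE v : v != vc -> v \notin pendants T -> l v = mu.
      move=> nv pv; have := pnbhd_noncentral_gt0 treeT diamT centT nv pv.
      by case/card_gt0P=> u; apply: lsup.
    apply/gcd_exponent_neq1 => //; exists mu.
      by rewrite -(muE a) // eq_sym; apply: contraTneq va => ->; rewrite adj_irrefl.
    apply/mudeg; rewrite degE p0 add0n -[RHS](wmu vc) weight_split (cards0_eq p0).
    rewrite big_set0 add0r -sumr_const; apply: eq_bigr => u.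
    rewrite finset.in_setD [u \in nbhd vc]inE => /andP[pu cu]; rewrite muE //.
    by rewrite eq_sym; apply: adj_neq.
  have lc : l vc = mu by case/card_gt0P: p0 => u; apply: lsup.
  have strong v : v != vc -> v \notin pendants T -> v \in strong_supports T.
    move=> nv pv; rewrite strongE ltn_neqAle.
    rewrite (pnbhd_noncentral_gt0 treeT diamT centT nv pv) andbT eq_sym.
    (* With a single pendant [u], the weight at [v] reads [mu + l u = mu], so [l u] would be 0. *)
    apply/negP=> /cards1P[u eu]; have := wmu v.
    rewrite (weight_noncentral treeT diamT centT) // lc eu big_set1 => e.
    have /eqP := l0 u; apply; apply: (addrI mu); by rewrite e addr0.
  have [p1|p1] := leqP #|pnbhd vc| 1.
    by apply: Or32; split=> //; rewrite weakE eqn_leq p1.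
  by apply: Or31 => v; have [->|nv] := eqVneq v vc; [rewrite strongE | apply: strong].
(* An element of infinite order serves as the weight whenever [vc] is a support. *)
have [h ntor] : exists h : G, ~ torsion_elt h by apply/existsNP.
have hn0 n : 0 < n -> (h *+ n != 0)%R by move=> n0; apply/eqP=> hn; apply: ntor; exists n.
have h0 : (h != 0)%R by have := hn0 1 isT.
have hD : (h *+ #|nbhd vc :\: pendants T| != h)%R.
  rewrite -(subnK (ltnW D2)) mulrnDr mulr1n -subr_eq0 addrK.
  by apply: hn0; rewrite subn_gt0.
case=> [strong|[weak strong]|[[neut|pend] gcd1]].
- apply: (magic_labeling_exists treeT diamT centT (mu := h) (c := h)) => //.
    by move=> v _ /strong; rewrite strongE => /[swap] ->.
  by have := strong _ vcN; rewrite strongE => p1; rewrite p1 (ltnW p1) eqxx.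
- apply: (magic_labeling_exists treeT diamT centT (mu := h) (c := h)) => //.
    by move=> v nv /(strong _ nv); rewrite strongE => /[swap] ->.
  by move: weak; rewrite weakE => /eqP->; rewrite eqxx hD.
- have [mu mu0 mum] := (gcd_exponent_neq1 G deg1).1 gcd1.
  (* With [c != mu], a lone pendant at a non-central support can take the nonzero label [mu - c]. *)
  have [c c0 cmu] := infinite_avoid2 0%R mu inf.
  apply: (magic_labeling_exists treeT diamT centT (mu := mu) (c := c)) => //.
    by move=> *; rewrite eq_sym.
  by rewrite neutE in neut; rewrite neut ((mudeg mu).2 mum) eqxx orbT.
- by rewrite pend in vcN.
Qed.
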